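(* There exist absolute constants $c,c_1,c_2,c_3,c_4>0$ such that for every $M_0\in\mathbb{Z}^+$ there is an integer $M$ with $c_1M_0\le M\le c_2M_0$ satisfying the following: for every (possibly randomized) allocator for Memory Reallocation with $M$ memory slots (where the total size of live objects may be as large as $M$), there is an update sequence, fixed in advance, in which all object sizes lie in $[c_3M^{4/7},\ c_4M^{4/7}]$ and total live size never exceeds $M$, such that some update has expected squared switching cost at least $cM^{9/7}$.
   Context: Memory Reallocation: memory of $M$ slots indexed $0,\dots,M-1$; a dynamic set $X$ of live objects with sizes $\mu(x)\in\mathbb{Z}^+$; an allocation is $\phi\colon X\to\{0,\dots,M-1\}$ with $\phi(x)+\mu(x)\le M$ and pairwise disjoint intervals $[\phi(x),\phi(x)+\mu(x))$. Starting from $X=\varnothing$, updates (insert a new object of given size / delete a live object) arrive online; after each the allocator outputs an allocation of the new set $X'$, possibly moving existing objects. The switching cost of an update inserting/deleting $x$ that changes $\phi$ to $\phi'$ is $\mu(x)+\sum_{y\in X\cap X',\ \phi(y)\ne\phi'(y)}\mu(y)$; the squared switching cost is its square. Expectations are over the allocator's randomness (oblivious adversary). *)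

(* Defs.v *)
From HB Require Import structures.
From mathcomp Require Import all_boot all_order all_algebra finmap.
From mathcomp Require Import all_classical all_reals all_analysis.
Set Implicit Arguments.
Unset Strict Implicit.
Unset Printing Implicit Defensive.
Local Open Scope nat_scope.

(* An object is a pair (name, size); the names provide an unlimited supply of
   distinct objects of each size. *)
Definition object : Type := (nat * nat)%type.

Definition mu (x : object) : nat := x.2.

Inductive update := Insert of object | Delete of object.

Definition updated_object (u : update) : object :=
  match u with Insert x => x | Delete x => x end.

Definition step (X : {fset object}) (u : update) : {fset object} :=
  match u with
  | Insert x => (x |` X)%fset
  | Delete x => (X `\ x)%fset
  end.

Definition live (s : seq update) : {fset object} := foldl step fset0 s.

Definition inserted (s : seq update) : seq object :=
  pmap (fun u => if u is Insert x then Some x else None) s.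

Definition total_size (X : {fset object}) : nat := \sum_(x <- X) mu x.

(* A new object is one that was never inserted before, not merely one that is
   not live at present. *)
Definition legal_update (M : nat) (s : seq update) (u : update) : Prop :=
  match u with
  | Insert x => [/\ 0 < mu x, x \notin inserted s
                  & total_size (live (rcons s u)) <= M]
  | Delete x => x \in live s
  end.

Inductive update_sequence (M : nat) : seq update -> Prop :=
| update_sequence_nil : update_sequence M [::]
| update_sequence_rcons s u :
    update_sequence M s -> legal_update M s u -> update_sequence M (rcons s u).

(* Only the values of phi on X matter: a map X -> {0, ..., M-1} is represented
   by any total extension of it. *)
Definition allocation (M : nat) (X : {fset object}) (phi : object -> nat) : Prop :=
  [/\ forall x, x \in X -> phi x < M,
      forall x, x \in X -> phi x + mu x <= M
    & forall x y, x \in X -> y \in X -> x <> y ->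
      forall k, ~ ((phi x <= k < phi x + mu x) /\ (phi y <= k < phi y + mu y))].

Definition switching_cost (X : {fset object}) (u : update)
    (phi phi' : object -> nat) : nat :=
  mu (updated_object u)
  + \sum_(y <- (X `&` step X u)%fset | phi y != phi' y) mu y.

(* [A w s] is the allocation output once the updates of s have been processed,
   when the random choices are w.  It depends on no later update (online), and
   w is drawn independently of the update sequence (oblivious adversary). *)
Definition randomized_allocator (M : nat) (d : measure_display)
    (Omega : measurableType d) (A : Omega -> seq update -> object -> nat) : Prop :=
  forall s, update_sequence M s ->
    (forall w, allocation M (live s) (A w s)) /\
    (forall x, x \in live s -> measurable_fun [set: Omega] (fun w => A w s x)).

(* Expected squared switching cost of the update u arriving after the updates
   of s. *)
Definition expected_sq_cost (R : realType) (d : measure_display)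
    (Omega : measurableType d) (P : probability Omega R)
    (A : Omega -> seq update -> object -> nat) (s : seq update) (u : update)
    : \bar R :=
  'E_P[fun w => ((switching_cost (live s) u (A w s) (A w (rcons s u))) ^ 2)%:R%R]%E.

(* Main.v *)
Require Import Defs.
From HB Require Import structures.
From mathcomp Require Import all_boot all_order all_algebra finmap zify lra.
From mathcomp Require Import all_classical all_reals all_analysis measurable_realfun.

(* Keep the memory exactly full.  If all sizes are [s] plus a small deviation,
   the place of an object in a full tiling is its rank times [s] plus the sum of
   the deviations before it, and these sums determine how many objects of each
   kind lie before it.  Hence an object that does not move keeps its rank, keeps
   the special object F on the same side, and sees the same objects before it as
   far as kinds are concerned, except for the exchange made in the round, which
   happens at F.  So a round in which k objects change place moves F by at most
   k ranks and transports a total (mass times distance) of at most O(k^2).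

   There are K objects of kind B or B', all of which are exchanged, B for B' or
   B' for B, in every cycle of K rounds, and 10 K^2 objects of kind A, one of
   which disappears in each round.  If the sum of the k^2 were o(K) per round,
   the B's would hardly be transported, so F, which exchanges all of them in
   each cycle, would have the same distribution of places in every cycle, within
   a window narrower than 5 K^2; but over all the rounds F has the distribution
   of the A's, which occupy 10 K^2 ranks.  With s of order K^4 and K^3 objects
   in all, M is of order K^7 and the mean squared cost is of order s^2 K. *)

Local Open Scope nat_scope.

(** * Transport on a line *)

Definition absd (m n : nat) : nat := (m - n) + (n - m).

Lemma absd_triangle m n p : absd m p <= absd m n + absd n p.
Proof. rewrite /absd; lia. Qed.

Lemma absdC m n : absd m n = absd n m.
Proof. by rewrite /absd addnC. Qed.

Lemma sum_absd_triangle N (f g h : nat -> nat) :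
  \sum_(i < N) absd (f i) (h i) <=
  \sum_(i < N) absd (f i) (g i) + \sum_(i < N) absd (g i) (h i).
Proof. rewrite -big_split; apply: leq_sum => i _; exact: absd_triangle. Qed.

Lemma absd_sum (I : Type) (r : seq I) (f g : I -> nat) :
  absd (\sum_(i <- r) f i) (\sum_(i <- r) g i) <= \sum_(i <- r) absd (f i) (g i).
Proof.
elim: r => [|x r IH]; first by rewrite !big_nil.
by rewrite !big_cons; move: IH; rewrite /absd; lia.
Qed.

Definition ncount (N : nat) (P : pred nat) : nat := \sum_(i < N) P i.

Lemma ncountS N P : ncount N.+1 P = ncount N P + P N.
Proof. by rewrite /ncount big_ord_recr. Qed.

Lemma leq_ncount m n P : m <= n -> ncount m P <= ncount n P.
Proof.
move=> /subnKC <-; elim: (n - m) => [|d IH]; first by rewrite addn0.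
by rewrite addnS ncountS (leq_trans IH) // leq_addr.
Qed.

Lemma ncount_range N (P : pred nat) i d :
  i + d < N -> (forall x, i < x <= i + d -> P x) -> d <= ncount N P.
Proof.
move=> le HP; apply: (@leq_trans (ncount (i + d).+1 P)); last exact: leq_ncount.
elim: d le HP => [//|d IH] le HP.
rewrite addnS ncountS HP; last by lia.
by rewrite addn1 ltnS IH //; [lia | move=> x Hx; apply: HP; lia].
Qed.

Lemma leq_sum_suffix (v N : nat) (f : nat -> nat) :
  v <= N -> \sum_(i < N - v) f (v + i) <= \sum_(i < N) f i.
Proof.
move=> vN; suff : \sum_(i < N - v) f (v + i) <= \sum_(i < v + (N - v)) f i.
  by rewrite subnKC.
by rewrite big_split_ord /= leq_addl.
Qed.

(* Between two consecutive good indices the discrepancy can only build up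
   by 2 per bad index, which is where the square comes from. *)
Lemma sum_absd_ncount N (bad : pred nat) (f g : nat -> nat) :
    f 0 = g 0 ->
    (forall i, absd (f i.+1 + g i) (f i + g i.+1) <= 2) ->
    (forall i, i < N -> ~~ bad i -> f i = g i) ->
  \sum_(i < N) absd (f i) (g i) <= 2 * ncount N bad ^ 2.
Proof.
move=> fg0 step good.
have loc i : i < N -> absd (f i) (g i) <= 2 * ncount i.+1 bad.
  elim: i => [|i IH] lti; first by rewrite fg0 /absd; lia.
  have [bi|/good -> //] := boolP (bad i.+1); last by rewrite /absd; lia.
  rewrite ncountS bi; have := IH (ltnW lti); have := step i.
  by rewrite /absd; lia.
rewrite expnS expn1 mulnA -{2}/(ncount N bad) /ncount mulnC big_distrl /=.
apply: leq_sum => i _; have [bi|/good -> //] := boolP (bad i).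
  rewrite mul1n; apply: leq_trans (loc _ (ltn_ord i)) _.
  by rewrite leq_mul2l leq_ncount.
by rewrite /absd; lia.
Qed.

(** Climbing from 0 by at most 1 per step, the sequence takes every value up to [a u], so its sum is
    at least the triangular number of [a u]. *)
Lemma sum_left_ramp (a : nat -> nat) u :
  (forall i, a i.+1 <= (a i).+1) -> a 0 = 0 ->
  a u ^ 2 <= 2 * \sum_(i < u.+1) a i.
Proof.
move=> lip a0; elim: u => [|u IH]; first by rewrite a0.
have -> : \sum_(i < u.+2) a i = \sum_(i < u.+1) a i + a u.+1 by rewrite big_ord_recr.
rewrite mulnDr -!mulnn; have := lip u.
by move: IH; rewrite -mulnn; case: (a u.+1) => [|x]; nia.
Qed.

Lemma sum_right_ramp (b : nat -> nat) d :
  (forall i, b i <= (b i.+1).+1) -> b d = 0 ->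
  b 0 ^ 2 <= 2 * \sum_(i < d) b i.
Proof.
elim: d b => [|d IH] b lip bd; first by rewrite bd.
have -> : \sum_(i < d.+1) b i = b 0 + \sum_(i < d) b i.+1.
  by rewrite big_ord_recl.
rewrite mulnDr; have := IH (fun i => b i.+1) (fun i => lip i.+1) bd; have := lip 0.
by rewrite -!mulnn; case: (b 0) => [|x]; nia.
Qed.

(** A rank separating [p j] from [p j.+1] changes side, hence is bad; so one round moves [p] by at
    most the number of bad ranks. *)
Lemma drift_bound N (p : nat -> nat) (bad : nat -> pred nat) n :
    (forall j, j < n -> p j < N) -> 
    (forall j i, j.+1 < n -> i < N -> ~~ bad j i -> (p j < i) = (p j.+1 < i)) ->
  forall j, j < n -> absd (p 0) (p j) <= \sum_(l < n) ncount N (bad l).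
Proof.
move=> pN side j ltj.
suff H : absd (p 0) (p j) <= \sum_(l < j) ncount N (bad l).
  apply: leq_trans H _; rewrite -(subnKC (ltnW ltj)) big_split_ord /=.
  exact: leq_addr.
elim: j ltj => [|j IH] ltj; first by rewrite /absd; lia.
rewrite big_ord_recr /=; apply: leq_trans (absd_triangle _ (p j) _) _.
rewrite leq_add ?IH //; first by lia.
have stepP x : x < N -> (p j < x) != (p j.+1 < x) -> bad j x.
  by move=> xN; apply: contraR => /(side _ _ ltj xN) ->.
have [le|le] := leqP (p j) (p j.+1).
  rewrite /absd (eqP le) add0n; apply: (@ncount_range _ _ (p j)).
    by rewrite subnKC // pN.
  by move=> x; rewrite subnKC // => Hx; apply: stepP; [have := pN _ ltj|]; lia.
rewrite /absd (_ : p j.+1 - p j = 0) ?addn0; last by lia.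
have := pN _ (ltnW ltj) => pjN.
apply: (@ncount_range _ _ (p j.+1)); first by lia.
by move=> x Hx; apply: stepP; lia.
Qed.

(** Here [p j] is the rank of F in state [j], while [a] and [c] count the A's and all the B's before
    a rank in the first state. By contradiction: if [S] is small, all cycles have nearly the profile
    of the first one, so [a] is nearly [10 * K] times that profile. But this profile rises from 0 to
    [K] within a window around [p 0] that is too narrow for [T] A's. *)
Lemma transport_bound N K (a : nat -> nat) (p : nat -> nat)
    (bad : nat -> pred nat) (T := 10 * K * K)
    (S := \sum_(j < T) ncount N (bad j) ^ 2) (c : nat -> nat) :
    0 < K ->
    a 0 = 0 -> a N = T -> (forall i, a i <= a i.+1 <= (a i).+1) ->
    (forall j, j < T -> p j < N) ->
    (forall j i, j.+1 < T -> i < N -> ~~ bad j i -> (p j < i) = (p j.+1 < i)) ->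
    \sum_(i < N) absd (a i) (\sum_(j < T) (p j < i)) <= 2 * S ->
    (forall x, x < 10 * K ->
       \sum_(i < N) absd (c i) (\sum_(j < K) (p (x * K + j) < i)) <= 4 * S) ->
  K * T <= 2000 * S.
Proof.
move=> K0 a0 aN lip pN side Ha Hc.
rewrite leqNgt; apply/negP => small.
pose R x i := \sum_(j < K) (p (x * K + j) < i).
pose V := \sum_(j < K) ncount N (bad j).
have K_T : K <= T by rewrite /T; nia.
(* From [K * n <= n ^ 2 + K * K] in each of the first [K] rounds. *)
have VS : K * V <= S + K * K * K.
  rewrite /V big_distrr /= /S -(subnKC K_T) big_split_ord /=.
  apply: (@leq_trans (\sum_(j < K) (ncount N (bad j) ^ 2 + K * K))).
    by apply: leq_sum => j _; rewrite expnS expn1; nia.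
  by rewrite big_split /= sum_nat_const card_ord; lia.
have drift j : j < K -> absd (p 0) (p j) <= V.
  apply: drift_bound => [i ?|i x ? ?]; first by apply: pN; lia.
  by apply: side; lia.
have RR x : x < 10 * K -> \sum_(i < N) absd (R x i) (R 0 i) <= 8 * S.
  move=> /Hc Hx; have /Hc H0 : 0 < 10 * K by lia.
  apply: leq_trans (sum_absd_triangle _ (R x) c (R 0)) _.
  rewrite [8 * S](_ : _ = 4 * S + 4 * S); last by lia.
  by apply: leq_add; rewrite // (eq_bigr _ (fun i _ => absdC _ _)).
have sumR i : \sum_(j < T) (p j < i) = \sum_(x < 10 * K) R x i.
  rewrite /T; elim: (10 * K) => [|m IH]; first by rewrite !big_ord0.
  by rewrite mulSnr big_split_ord /= IH [in RHS]big_ord_recr.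
(* [2 * S] for passing from [a] to the places of F over all rounds, and [8 * S] for replacing each
   of the [10 * K] cycles by the first one. *)
have main : \sum_(i < N) absd (a i) (10 * K * R 0 i) <= 82 * K * S.
  apply: leq_trans (sum_absd_triangle _ a (fun i => \sum_(j < T) (p j < i)) (fun i => 10 * K * R 0 i)) _.
  apply: (@leq_trans (2 * S + \sum_(x < 10 * K) 8 * S)); last first.
    by rewrite sum_nat_const card_ord; nia.
  rewrite leq_add //.
  apply: (@leq_trans (\sum_(x < 10 * K) \sum_(i < N) absd (R x i) (R 0 i))).
    rewrite exchange_big /=; apply: leq_sum => i _.
    rewrite sumR [10 * K * _](_ : _ = \sum_(x < 10 * K) R 0 i).
      exact: absd_sum.
    by rewrite sum_nat_const card_ord.
  by apply: leq_sum => x _; apply: RR.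
have p0N : p 0 < N by apply: pN; lia.
have Rlow i : i <= p 0 - V -> R 0 i = 0.
  move=> Hi; rewrite /R big1 // => j _; have := drift _ (ltn_ord j).
  by rewrite mul0n add0n /absd; lia.
have Rhigh i : p 0 + V < i -> R 0 i = K.
  move=> Hi; rewrite /R (eq_bigr (fun=> 1)) ?sum_nat_const ?card_ord ?muln1 //.
  move=> j _; have := drift _ (ltn_ord j).
  by rewrite mul0n add0n /absd; lia.
have amon i d : a i <= a (i + d) <= a i + d.
  by elim: d => [|d IH]; [rewrite !addn0 leqnn | rewrite !addnS; have := lip (i + d); lia].
(* Up to [u] the profile [R 0] is 0 and from [v] on it is [K]. There [a], respectively [T - a], is
   bounded by the discrepancy in [main] and forms a ramp. *)
pose u := p 0 - V; pose v := (p 0 + V).+1.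
have left : a u ^ 2 <= 2 * (82 * K * S).
  apply: leq_trans (sum_left_ramp _ u _ a0) _ => [i|]; first by have := lip i; lia.
  rewrite leq_mul2l /=; apply: leq_trans main.
  have uN : u.+1 <= N by rewrite /u; lia.
  rewrite -(subnKC uN) big_split_ord /=; apply: leq_trans (leq_addr _ _).
  apply: leq_sum => i _; rewrite Rlow; first by rewrite /absd; lia.
  by have := ltn_ord i; rewrite /u; lia.
have right : (T - a v) ^ 2 <= 2 * (82 * K * S).
  have [Nv|vN] := leqP N v.
    by have := amon N (v - N); rewrite subnKC // aN => H; rewrite (_ : T - a v = 0) //; lia.
  have := sum_right_ramp (fun i => T - a (v + i)) (N - v).
  rewrite subnKC ?(ltnW vN) // aN addn0 => H.
  apply: leq_trans (H _ _) _ => [i||]; [by rewrite addnS; have := lip (v + i); lia | by lia |].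
  rewrite leq_mul2l /=; apply: leq_trans main.
  apply: leq_trans (leq_sum_suffix v N (fun i => absd (a i) (10 * K * R 0 i)) (ltnW vN)).
  apply: leq_sum => i _; rewrite Rhigh; first by rewrite /absd /T; lia.
  by rewrite /v /=; lia.
have width : T <= a u + (T - a v) + 2 * V + 1.
  have := amon u (v - u); rewrite subnKC; last by rewrite /u /v; lia.
  by rewrite /u /v; lia.
have KKK : K <= K * K * K by rewrite -mulnA leq_pmulr // muln_gt0 K0.
have KT : K * T = 10 * (K * K * K) by rewrite /T; lia.
set x := a u in left width; set y := T - a v in right width.
(* By [small] and [VS], [2 * V + 1] is less than a third of [T], so most A's lie outside the
   window. *)
have {}width : T <= 4 * (x + y).
  rewrite -(leq_pmul2l K0).
  have : K * T <= K * (x + y + 2 * V + 1) by rewrite leq_mul2l width orbT.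
  have -> : K * (x + y + 2 * V + 1) = K * (x + y) + 2 * (K * V) + K by lia.
  by rewrite [K * (4 * _)]mulnCA KT; lia.
(* Now [T * T] is at most [32 * (x ^ 2 + y ^ 2)], hence at most [10496 * K * S], whereas [TT] and
   [small] make it exceed [20000 * K * S]. *)
have sq : T * T <= 4 * (x + y) * (4 * (x + y)) by apply: leq_mul.
have TT : T * T = 10 * (K * (K * T)) by rewrite {1}/T; lia.
have KS : K * (2000 * S).+1 <= K * (K * T) by rewrite leq_mul2l small orbT.
move: left right sq TT KS; rewrite mulnS [K * (2000 * S)]mulnCA -!mulnn.
rewrite -[82 * K * S]mulnA; move: (K * S) (K * (K * T)) (T * T) => KS KKT TT.
by move: x y {width} => {}x {}y; have := (nat_Cauchy x y).1; rewrite -!mulnn; lia.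
Qed.

(** * Rigidity of words of deviations *)

(** The errors in [X j = X j.+1 + q j] add up by the triangle inequality; the rounds outside the
    range only enlarge the right side. *)
Lemma telescope_absd N T m n (X q : nat -> nat -> nat) (k : nat -> nat) :
    m + n <= T ->
    (forall j, m <= j < m + n ->
       \sum_(i < N) absd (X j i) (X j.+1 i + q j i) <= 2 * k j ^ 2) ->
  \sum_(i < N) absd (X m i) (X (m + n) i + \sum_(l < n) q (m + l) i)
    <= 2 * \sum_(j < T) k j ^ 2.
Proof.
move=> mnT step; apply: (@leq_trans (2 * \sum_(l < n) k (m + l) ^ 2)); last first.
  rewrite leq_mul2l /=; apply: (@leq_trans (\sum_(j < m + n) k j ^ 2)).
    by rewrite big_split_ord /= leq_addl.
  by rewrite -(subnKC mnT) [X in _ <= X]big_split_ord /= leq_addr.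
elim: n {mnT} step => [|n IH] step.
  rewrite big1 ?leq0n // => i _; rewrite addn0 big_ord0 addn0.
  by rewrite /absd subnn.
rewrite big_ord_recr mulnDr /=.
apply: leq_trans (sum_absd_triangle _ (X m)
  (fun i => X (m + n) i + \sum_(l < n) q (m + l) i)
  (fun i => X (m + n.+1) i + \sum_(l < n.+1) q (m + l) i)) _.
apply: leq_add; first by apply: IH => j Hj; apply: step; lia.
apply: leq_trans (step (m + n) _); last by lia.
apply: leq_sum => i _; rewrite big_ord_recr /= addnS /absd; lia.
Qed.

(* The memory is kept full, up to a few updates, with objects of size
   [unit_size K + d].  The deviation [d] is 0 for fillers, 1 for [aobj], [devB K]
   or [devB' K] for [bobj]; the one object [fobj] of the j-th state has the
   deviation [fdev K j], above [2 * cap K], that makes the total exact.  The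
   numbers of the other kinds are digits in a mixed radix, so a sum of
   deviations determines them. *)
Definition nrounds (K : nat) := 10 * K * K.
Definition devB (K : nat) := (nrounds K).+1.
Definition devB' (K : nat) := devB K * K.+1.
Definition cap (K : nat) := devB' K * K.+1.

(** The kind alternates between blocks of [K] indices, so [i] and [i + K] have opposite kinds. *)
Definition bdev (K i : nat) : nat := if odd (i %/ K) then devB' K else devB K.

Definition numB (K j : nat) : nat := count (fun i => ~~ odd (i %/ K)) (iota j K).
Definition numB' (K j : nat) : nat := count (fun i => odd (i %/ K)) (iota j K).

Definition content (K a b b' : nat) : nat := a + devB K * b + devB' K * b'.

Definition fdev (K j : nat) : nat :=
  3 * cap K - content K (nrounds K - j) (numB K j) (numB' K j).

Definition devs (K n0 j : nat) : seq nat :=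
  nseq (n0 + j) 0 ++ nseq (nrounds K - j) 1 ++ map (bdev K) (iota j K)
    ++ [:: fdev K j].

Lemma size_devs K n0 j : j <= nrounds K -> size (devs K n0 j) = n0 + nrounds K + K + 1.
Proof. by move=> ?; rewrite !size_cat !size_nseq size_map size_iota /=; lia. Qed.

Lemma numB_add K j : numB K j + numB' K j = K.
Proof. by rewrite addnC /numB /numB' count_predC size_iota. Qed.

Lemma count_iotaS (P : pred nat) j K :
  count P (iota j K) + P (j + K) = P j + count P (iota j.+1 K).
Proof.
have -> : P (j + K) = count P (iota (j + K) 1) :> nat by rewrite /= addn0.
by rewrite -count_cat -iotaD addn1.
Qed.

Lemma odd_shift K j : 0 < K -> odd ((j + K) %/ K) = ~~ odd (j %/ K).
Proof. by move=> K0; rewrite divnDr // divnn K0 addn1. Qed.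

(** The next state drops the index [j] and takes in [j + K], of the opposite kind, so one unit
    passes from one count to the other. *)
Lemma numB_step K j : 0 < K ->
  (numB K j = numB K j.+1 + ~~ odd (j %/ K) - odd (j %/ K)) /\
  (numB' K j = numB' K j.+1 + odd (j %/ K) - ~~ odd (j %/ K)).
Proof.
move=> K0; have := count_iotaS (fun i => ~~ odd (i %/ K)) j K.
have := count_iotaS (fun i => odd (i %/ K)) j K.
rewrite -/(numB K j) -/(numB' K j) -/(numB K j.+1) -/(numB' K j.+1) /=.
by rewrite (odd_shift _ _ K0); case: (odd _) => /=; lia.
Qed.

(** At a multiple of [K] the window is one whole block, all of the same kind. *)
Lemma numB_cycle K x : 0 < K ->
  numB K (x * K) = (if odd x then 0 else K) /\
  numB' K (x * K) = (if odd x then K else 0).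
Proof.
move=> K0.
have H : numB' K (x * K) = if odd x then K else 0.
  rewrite /numB' (@eq_in_count _ _ (fun=> odd x)) => [|i].
    by case: (odd x); rewrite ?count_predT ?count_pred0 ?size_iota.
  rewrite mem_iota => Hi; congr odd.
  by apply/eqP; rewrite eqn_leq -ltnS ltn_divLR // leq_divRL //; lia.
by split => //; have := numB_add K (x * K); rewrite H; case: (odd x); lia.
Qed.

(** [cap K] is the product of the three radices [devB K], [K.+1] and [K.+1]. *)
Lemma content_lt K a b b' :
  a <= nrounds K -> b <= K -> b' <= K -> content K a b b' < cap K.
Proof. by rewrite /content /cap /devB' /devB; move: (nrounds K) => T; nia. Qed.

Lemma content_inj K a b b' a2 b2 b2' :
    a <= nrounds K -> b <= K -> a2 <= nrounds K -> b2 <= K ->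
  content K a b b' = content K a2 b2 b2' -> [/\ a = a2, b = b2 & b' = b2'].
Proof.
rewrite /content /devB' => Ha Hb Ha2 Hb2.
have digit d x y x2 y2 : x < d -> x2 < d -> x + d * y = x2 + d * y2 -> x = x2 /\ y = y2.
  move=> xd x2d e; have d0 : 0 < d by lia.
  have := congr1 (modn^~ d) e; rewrite ![d * _]mulnC ![_ + _ * d]addnC !modnMDl !modn_small // => exx.
  by split => //; move: e; rewrite exx => /addnI /eqP; rewrite eqn_pmul2l // => /eqP.
(* Horner form, from which [digit] removes the two lowest digits in turn. *)
have shape u w z : u + devB K * w + devB K * K.+1 * z = u + devB K * (w + K.+1 * z) by lia.
rewrite !shape => /digit [] //; rewrite ?ltnS // => -> /digit [] //.
Qed.

Lemma dev_order K : 0 < K -> [/\ 1 < devB K, devB K < devB' K & devB' K < cap K].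
Proof. by rewrite /cap /devB' /devB /nrounds; split; nia. Qed.

Lemma numB_leq K j : numB K j <= K /\ numB' K j <= K.
Proof. by have := numB_add K j; lia. Qed.

Lemma fdev_bounds K j : 2 * cap K < fdev K j <= 3 * cap K.
Proof.
have [b b'] := numB_leq K j.
by have := content_lt _ _ _ _ (leq_subr j (nrounds K)) b b'; rewrite /fdev; lia.
Qed.

Lemma fdev_content K j :
  fdev K j + content K (nrounds K - j) (numB K j) (numB' K j) = 3 * cap K.
Proof.
have [b b'] := numB_leq K j.
by have := content_lt _ _ _ _ (leq_subr j (nrounds K)) b b'; rewrite /fdev; lia.
Qed.

Lemma sumn_content K f s : 0 < K -> cap K < f ->
    all (mem [:: 0; 1; devB K; devB' K; f]) s ->
  sumn s = content K (count_mem 1 s) (count_mem (devB K) s) (count_mem (devB' K) s)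
           + f * count_mem f s.
Proof.
move=> K0 lt_f; have [h1 h2 h3] := dev_order K K0.
elim: s => [|x s IH] /=; first by rewrite /content; lia.
move=> /andP [xin /IH ->]; move: xin; rewrite /content !inE.
move=> /or4P [/eqP -> | /eqP -> | /eqP -> | /orP [/eqP -> | /eqP ->]].
all: rewrite ?eqxx; do ?[case: eqP => [?|_]; first by exfalso; lia].
all: by move: (count_mem 1 s) (count_mem (devB K) s) (count_mem (devB' K) s) (count_mem f s) => a b c d; lia.
Qed.

Lemma count_devs K n0 j : 0 < K ->
  [/\ count_mem 1 (devs K n0 j) = nrounds K - j,
      count_mem (devB K) (devs K n0 j) = numB K j,
      count_mem (devB' K) (devs K n0 j) = numB' K j,
      count_mem (fdev K j) (devs K n0 j) = 1 &
      all (mem [:: 0; 1; devB K; devB' K; fdev K j]) (devs K n0 j)].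
Proof.
move=> K0; have [h1 h2 h3] := dev_order K K0; have := fdev_bounds K j => hf.
have cB d : count_mem d (map (bdev K) (iota j K)) =
    (d == devB K) * numB K j + (d == devB' K) * numB' K j.
  rewrite count_map /numB /numB'; elim: (iota j K) => [|i s IH] /=; first by lia.
  by rewrite IH /bdev; case: odd => /=; rewrite (eq_sym d); case: eqP => ?; lia.
split; rewrite ?count_cat ?count_nseq ?cB /=; try by
  rewrite ?eqxx; do ?[rewrite (_ : (_ == _) = false); last by lia]; lia.
rewrite !all_cat !all_nseq /= !inE !eqxx !orbT /= andbT.
by apply/allP => _ /mapP [i _ ->]; rewrite /bdev !inE; case: odd; rewrite eqxx !orbT.
Qed.

Lemma leq_count_take (T : Type) (P : pred T) i (s : seq T) :
  count P (take i s) <= count P s.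
Proof. by rewrite -{2}(cat_take_drop i s) count_cat leq_addr. Qed.

(** The word contains F exactly once, so its count in a prefix is the indicator that its index lies
    there. *)
Lemma prefix_content K n0 j (v : seq nat) i :
    0 < K -> perm_eq v (devs K n0 j) ->
  [/\ sumn (take i v) = content K (count_mem 1 (take i v))
        (count_mem (devB K) (take i v)) (count_mem (devB' K) (take i v))
        + fdev K j * (index (fdev K j) v < i),
      count_mem 1 (take i v) <= nrounds K - j,
      count_mem (devB K) (take i v) <= numB K j
    & count_mem (devB' K) (take i v) <= numB' K j].
Proof.
move=> K0 pv; have [c1 cB cB' cf va] := count_devs K n0 j K0.
split; first 1 last.
- by rewrite -c1 -(permP pv) leq_count_take.
- by rewrite -cB -(permP pv) leq_count_take.
- by rewrite -cB' -(permP pv) leq_count_take.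
have capf : cap K < fdev K j by have := fdev_bounds K j; lia.
have vall : all (mem [:: 0; 1; devB K; devB' K; fdev K j]) (take i v).
  by apply/allP => x /mem_take; rewrite (perm_mem pv) => /(allP va).
rewrite (sumn_content _ _ _ K0 capf vall).
congr (_ + _ * _).
have fv : fdev K j \in v by rewrite -has_pred1 has_count (permP pv) cf.
rewrite -in_take //; have := leq_count_take _ (pred1 (fdev K j)) i v.
by rewrite (permP pv) cf -has_pred1 has_count; case: (count _ _) => [|[]].
Qed.

(** The deviation of F exceeds [2 * cap K] and the rest of a prefix stays below [cap K], so both
    prefixes contain F or neither does. Without F, equal sums mean equal digits. With F, the
    suffixes have equal digits, and the prefixes differ by the exchange of the round. *)
Lemma rigid_step K n0 j (v w : seq nat) i (o := odd (j %/ K))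
    (h := index (fdev K j) v < i) :
    0 < K -> j < nrounds K ->
    perm_eq v (devs K n0 j) -> perm_eq w (devs K n0 j.+1) ->
    sumn (take i v) = sumn (take i w) ->
  [/\ (index (fdev K j.+1) w < i) = h,
      count_mem 1 (take i v) = count_mem 1 (take i w) + h,
      count_mem (devB K) (take i v) + (h && o) =
        count_mem (devB K) (take i w) + (h && ~~ o)
    & count_mem (devB' K) (take i v) + (h && ~~ o) =
        count_mem (devB' K) (take i w) + (h && o)].
Proof.
move=> K0 jT pv pw.
have [-> a1 b1 b1'] := prefix_content _ _ _ _ i K0 pv.
have [-> a2 b2 b2'] := prefix_content _ _ _ _ i K0 pw.
rewrite -/h; set h2 := index _ w < i.
move: (count_mem 1 (take i v)) (count_mem (devB K) (take i v)) (count_mem (devB' K) (take i v)) a1 b1 b1'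
 => a b b' a1 b1 b1'.
move: (count_mem 1 (take i w)) (count_mem (devB K) (take i w)) (count_mem (devB' K) (take i w)) a2 b2 b2'
 => {}i' c c' a2 b2 b2'.
have [n1 n1'] := numB_leq K j; have [n2 n2'] := numB_leq K j.+1.
have l1 : content K a b b' < cap K.
  by apply: content_lt; [apply: leq_trans a1 (leq_subr _ _) | apply: leq_trans n1 | apply: leq_trans n1'].
have l2 : content K i' c c' < cap K.
  by apply: content_lt; [apply: leq_trans a2 (leq_subr _ _) | apply: leq_trans n2 | apply: leq_trans n2'].
have f1 := fdev_bounds K j; have f2 := fdev_bounds K j.+1.
case: h h2 => -[]; rewrite ?muln1 ?muln0 ?addn0 => E; try by exfalso; lia.
(* Both totals are [3 * cap K], so the deviations of F drop out when the suffixes are compared. *)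
- have E' : content K (nrounds K - j - a) (numB K j - b) (numB' K j - b') =
      content K (nrounds K - j.+1 - i') (numB K j.+1 - c) (numB' K j.+1 - c').
    have F1 := fdev_content K j; have F2 := fdev_content K j.+1.
    move: (leq_mul (leqnn (devB K)) b1) (leq_mul (leqnn (devB K)) b2)
      (leq_mul (leqnn (devB' K)) b1') (leq_mul (leqnn (devB' K)) b2').
    by move: F1 F2 E a1 a2; clear; rewrite /content !mulnBr; lia.
  have [|||| e1 e2 e3] := content_inj _ _ _ _ _ _ _ _ _ _ _ E'.
  + exact: leq_trans (leq_subr _ _) (leq_subr _ _).
  + exact: leq_trans (leq_subr _ _) n1.
  + exact: leq_trans (leq_subr _ _) (leq_subr _ _).
  + exact: leq_trans (leq_subr _ _) n2.
  have [s1 s1'] := numB_step K j K0; rewrite -/o in s1 s1'.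
  have S := numB_add K j; have S2 := numB_add K j.+1.
  split => //=.
  + by move: e1 a1 a2 jT; clear; lia.
  + by move: e2 b1 b2 s1 s1' S S2; clear; case: (o) => /=; lia.
  + by move: e3 b1' b2' s1 s1' S S2; clear; case: (o) => /=; lia.
- have [|||| -> -> ->] := content_inj _ _ _ _ _ _ _ _ _ _ _ E.
  + exact: leq_trans a1 (leq_subr _ _).
  + exact: leq_trans b1 n1.
  + exact: leq_trans a2 (leq_subr _ _).
  + exact: leq_trans b2 n2.
  by split.
Qed.

Lemma count_take_step (T : Type) (P : pred T) i (s : seq T) :
  count P (take i s) <= count P (take i.+1 s) <= (count P (take i s)).+1.
Proof.
have : count P (take 1 (drop i s)) <= 1.
  by case: (drop i s) => [|x l] //=; rewrite take0 /= addn0 leq_b1.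
by rewrite -[i.+1]addn1 takeD count_cat; lia.
Qed.

(** Ranks that are not bad are rigid, which feeds [transport_bound]. The A's vanish one per round at
    the place of F, so their first profile is carried to the places of F over all rounds. The joint
    profile of the B's is not affected by exchanges, and over a cycle the kind present at its start
    leaves at the places of F. *)
Lemma words_bound K n0 (v : nat -> seq nat) (N := n0 + nrounds K + K + 1) :
    0 < K -> (forall j, j <= nrounds K -> perm_eq (v j) (devs K n0 j)) ->
  K * nrounds K <= 2000 * \sum_(j < nrounds K)
    ncount N (fun i => sumn (take i (v j)) != sumn (take i (v j.+1))) ^ 2.
Proof.
move=> K0 pv; pose p j := index (fdev K j) (v j).
pose bad j i := sumn (take i (v j)) != sumn (take i (v j.+1)).
pose cA j i := count_mem 1 (take i (v j)).
pose cB j i := count_mem (devB K) (take i (v j)).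
pose cB' j i := count_mem (devB' K) (take i (v j)).
have rigid j i : j < nrounds K -> ~~ bad j i -> _ :=
  fun jT e => rigid_step K n0 j _ _ i K0 jT (pv j (ltnW jT)) (pv j.+1 jT) (eqP (negbNE e)).
have oddcyc x l : l < K -> odd ((x * K + l) %/ K) = odd x.
  by move=> lK; rewrite divnMDl // divn_small // addn0.
have totB j : j <= nrounds K ->
    (forall i, cB j i <= numB K j) /\ (forall i, cB' j i <= numB' K j).
  by move=> /pv pj; split=> i; have [] := prefix_content K n0 j _ i K0 pj.
have stepA i j : cA j i <= cA j i.+1 <= (cA j i).+1 := count_take_step _ _ i (v j).
have stepB i j : cB j i <= cB j i.+1 <= (cB j i).+1 := count_take_step _ _ i (v j).
have stepB' i j : cB' j i <= cB' j i.+1 <= (cB' j i).+1 := count_take_step _ _ i (v j).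
have Sb x : x <= 10 * K -> x * K <= nrounds K by move=> xK; rewrite leq_mul2r xK orbT.
apply: (transport_bound N K (cA 0) p bad (fun i => cB 0 i + cB' 0 i)) => //.
- by rewrite /cA take0.
- rewrite /cA take_oversize; last by rewrite (perm_size (pv 0 _)) // size_devs.
  by rewrite (permP (pv 0 _)) // (let: And5 c _ _ _ _ := count_devs K n0 0 K0 in c) subn0.
- move=> j jT; rewrite /p /N -(size_devs K n0 j (ltnW jT)) -(perm_size (pv j (ltnW jT))).
  rewrite index_mem -has_pred1 has_count (permP (pv j (ltnW jT))).
  by have [_ _ _ ->] := count_devs K n0 j K0.
- by move=> j i jT _ /(rigid _ _ (ltnW jT)) [].
(* No A is left in the last state, so the telescoped sum retains only the places of F. *)
- have zero i : cA (nrounds K) i = 0.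
    have [_ + _ _] := prefix_content K n0 (nrounds K) _ i K0 (pv _ (leqnn _)).
    by rewrite subnn leqn0 => /eqP.
  apply: leq_trans (telescope_absd N (nrounds K) 0 (nrounds K) cA
    (fun j i => p j < i) (fun j => ncount N (bad j)) (leqnn _) _).
    by apply: leq_sum => i _; rewrite add0n zero add0n.
  move=> j /= jT;
  apply: (sum_absd_ncount N (bad j) (cA j) (fun i => cA j.+1 i + (p j < i))) => [|i|i iN /(rigid _ _ jT) []] //.
    by rewrite /cA !take0.
  by have := stepA i j; have := stepA i j.+1; rewrite /absd; lia.
move=> x xK; have x1K : x * K + K <= nrounds K by rewrite -mulSnr Sb.
have xT := Sb x (ltnW xK).
(* Exchanging B for B' keeps the joint count, hence [q] is 0 here. *)
have cyc0 : \sum_(i < N) absd (cB 0 i + cB' 0 i) (cB (x * K) i + cB' (x * K) i)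
    <= 2 * \sum_(j < nrounds K) ncount N (bad j) ^ 2.
  apply: leq_trans (telescope_absd N (nrounds K) 0 (x * K)
    (fun j i => cB j i + cB' j i) (fun _ _ => 0) (fun j => ncount N (bad j)) xT _).
    by apply: leq_sum => i _; rewrite add0n big1 ?addn0.
  move=> j /= jx; have jT : j < nrounds K by lia.
  apply: (sum_absd_ncount N (bad j) (fun i => cB j i + cB' j i)
    (fun i => cB j.+1 i + cB' j.+1 i + 0)) => [|i|i iN /(rigid _ _ jT) [_ _]] //.
  - by rewrite /cB /cB' !take0.
  - have D : devB K != devB' K by have [_ h _] := dev_order K K0; rewrite neq_ltn h.
    (* One predicate counts both kinds together, so the joint count also grows by at most 1 per
       rank. *)
    have E l i' : cB l i' + cB' l i' =
        count (predU (pred1 (devB K)) (pred1 (devB' K))) (take i' (v l)).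
      rewrite -count_predUI (@eq_count _ (predI _ _) pred0) ?count_pred0 ?addn0 // => y /=.
      by apply/negbTE/andP => -[/eqP -> /eqP e]; rewrite e eqxx in D.
    have H l : cB l i + cB' l i <= cB l i.+1 + cB' l i.+1 <= (cB l i + cB' l i).+1.
      by rewrite !E count_take_step.
    by have := H j; have := H j.+1; rewrite /absd; lia.
  - by rewrite -/(cB j i) -/(cB' j i) -/(cB j.+1 i) -/(cB' j.+1 i); lia.
have cyc1 : \sum_(i < N) absd (cB (x * K) i + cB' (x * K) i) (\sum_(j < K) (p (x * K + j) < i))
    <= 2 * \sum_(j < nrounds K) ncount N (bad j) ^ 2.
  have [nb nb'] := numB_cycle K x K0; have [mb mb'] := numB_cycle K x.+1 K0.
  have [tb tb'] := totB _ xT; have [ub ub'] := totB _ x1K.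
  rewrite mulSnr /= in mb mb'.
  (* The kind that all the B's have at the start of cycle [x], and none at its end. *)
  pose Y := if odd x then cB' else cB.
  have Y0 i : Y (x * K) i = cB (x * K) i + cB' (x * K) i.
    by have := tb i; have := tb' i; rewrite /Y nb nb'; case: (odd x); lia.
  have Y1 i : Y (x * K + K) i = 0.
    by have := ub i; have := ub' i; rewrite /Y mb mb'; case: (odd x) => /=; lia.
  apply: leq_trans (telescope_absd N (nrounds K) (x * K) K Y (fun j i => p j < i)
    (fun j => ncount N (bad j)) x1K _).
    by apply: leq_sum => i _; rewrite Y0 Y1 add0n.
  move=> j jx; have jT : j < nrounds K by lia.
  have oj : odd (j %/ K) = odd x by rewrite -(oddcyc x (j - x * K)) ?subnKC //; lia.
  apply: (sum_absd_ncount N (bad j) (Y j) (fun i => Y j.+1 i + (p j < i))) => [|i|i iN /(rigid _ _ jT) [_ _]] //.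
  - by rewrite /Y /cB /cB'; case: odd; rewrite !take0.
  - have := stepB i j; have := stepB i j.+1; have := stepB' i j; have := stepB' i j.+1.
    by rewrite /Y /absd; case: odd; lia.
  - rewrite oj /Y -/(p j) -/(cB j i) -/(cB' j i) -/(cB j.+1 i) -/(cB' j.+1 i).
    by case: odd => /=; rewrite ?andbT ?andbF; lia.
apply: leq_trans (sum_absd_triangle _ (fun i => cB 0 i + cB' 0 i)
  (fun i => cB (x * K) i + cB' (x * K) i) (fun i => \sum_(j < K) (p (x * K + j) < i))) _.
by apply: leq_trans (leq_add cyc0 cyc1) _; rewrite -mulnDl.
Qed.

(** * Full tilings and update sequences *)

Lemma last_position (phi : object -> nat) x w :
  path (fun y z => phi y + mu y <= phi z) x w ->
  phi x + \sum_(y <- x :: w) mu y <= phi (last x w) + mu (last x w).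
Proof.
elim: w x => [|y w IH] x /=; first by rewrite big_seq1.
by move=> /andP [xy /IH]; rewrite !big_cons => H; lia.
Qed.

(** The chain of intervals lies between [c] and [M] and its total size fills that range, so its
    first interval must start at [c]; the rest is then packed from there on. *)
Lemma packed_position M (phi : object -> nat) (w : seq object) c :
    sorted (fun y z => phi y + mu y <= phi z) w ->
    (forall x, x \in w -> c <= phi x /\ phi x + mu x <= M) ->
    M <= c + \sum_(x <- w) mu x ->
  forall x0 i, i < size w -> phi (nth x0 w i) = c + \sum_(x <- take i w) mu x.
Proof.
elim: w c => [//|x w IH] c /= pw bnd full x0 i lti.
have px : phi x = c.
  have [cx _] := bnd x (mem_head _ _); have [_ ub] := bnd _ (mem_last x w).
  apply/eqP; rewrite eqn_leq cx andbT -(leq_add2r (\sum_(y <- x :: w) mu y)).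
  exact: leq_trans (leq_trans (last_position _ _ _ pw) ub) full.
case: i lti => [|i] lti /=; first by rewrite big_nil addn0.
rewrite big_cons addnA; apply: IH => //; first exact: path_sorted pw.
- move=> y yw; have [_ ub] := bnd y (mem_behead (s := x :: w) yw); split => //.
  have tr : transitive (fun y z => phi y + mu y <= phi z) by move=> a b d; lia.
  by rewrite -px; apply: (allP (order_path_min tr pw)).
- by move: full; rewrite big_cons addnA.
Qed.

Lemma sort_disjoint (phi : object -> nat) (w : seq object) :
    uniq w -> sorted (fun y z => phi y <= phi z) w ->
    (forall x y, x \in w -> y \in w -> x != y -> phi x <= phi y -> phi x + mu x <= phi y) ->
  sorted (fun y z => phi y + mu y <= phi z) w.
Proof.
case: w => [//|x w]; elim: w x => [//|y w IH] x /= /andP [xn un] /andP [xy pw] H.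
apply/andP; split; last first.
  apply: IH => // a b aw bw; apply: H; by rewrite inE ?aw ?bw orbT.
apply: H => //; first exact: mem_head.
  by rewrite !inE eqxx orbT.
by apply: contraNneq xn => ->; rewrite mem_head.
Qed.

Definition tiling_order (phi : object -> nat) (X : {fset object}) : seq object :=
  sort (fun y z => phi y <= phi z) X.

Lemma perm_tiling_order phi X : perm_eq (tiling_order phi X) X.
Proof. by rewrite perm_sort. Qed.

Lemma full_tiling M X (phi : object -> nat) :
    allocation M X phi -> (forall x, x \in X -> 0 < mu x) -> total_size X = M ->
  forall x0 i, i < size X -> phi (nth x0 (tiling_order phi X) i) =
    \sum_(x <- take i (tiling_order phi X)) mu x.
Proof.
move=> [_ inM dis] pos tot x0 i; have pw := perm_tiling_order phi X.
rewrite -(perm_size pw) => lti.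
rewrite -[RHS]add0n; apply: (packed_position M _ _ 0) => //.
- apply: sort_disjoint; first by rewrite (perm_uniq pw) fset_uniq.
    by apply: sort_sorted => x y; apply: leq_total.
  move=> x y; rewrite !(perm_mem pw) => xX yX /eqP nxy le.
  (* If the interval of [x] passed [phi y], the slot [phi y] would lie in both intervals, since
     sizes are positive. *)
  rewrite leqNgt; apply/negP => gt; apply: (dis x y xX yX nxy (phi y)).
  by have := pos y yX; lia.
- by move=> x; rewrite (perm_mem pw) => /inM.
- by rewrite add0n -tot /total_size (perm_big _ pw).
Qed.

Lemma live_cat s t : live (s ++ t) = foldl step (live s) t.
Proof. by rewrite /live foldl_cat. Qed.

Lemma mem_live_inserts s ls x :
  (x \in live (s ++ map Insert ls)) = (x \in live s) || (x \in ls).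
Proof.
rewrite live_cat; elim: ls (live s) => [|y ls IH] X /=; first by case: (x \in X).
by rewrite IH !inE; case: (x == y) (x \in X) (x \in ls) => [] [] [].
Qed.

Lemma mem_live_deletes s ds x :
  (x \in live (s ++ map Delete ds)) = (x \in live s) && (x \notin ds).
Proof.
rewrite live_cat; elim: ds (live s) => [|y ds IH] X /=; first by case: (x \in X).
by rewrite IH !inE; case: (x == y) (x \in X) (x \in ds) => [] [] [].
Qed.

Lemma inserted_cat s t : inserted (s ++ t) = inserted s ++ inserted t.
Proof. by rewrite /inserted pmap_cat. Qed.

Lemma inserted_inserts ls : inserted (map Insert ls) = ls.
Proof. by elim: ls => //= x ls ->. Qed.

Lemma inserted_deletes ds : inserted (map Delete ds) = [::].
Proof. by elim: ds. Qed.

Lemma leq_sum_sub (s t : seq object) (P : pred object) (f : object -> nat) :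
  uniq s -> uniq t -> {subset s <= t} ->
  \sum_(x <- s | P x) f x <= \sum_(x <- t | P x) f x.
Proof.
move=> us ut sub; rewrite (bigID (mem s) (fun i => P i) (r := t)) /=.
apply: leq_trans (leq_addr _ _); under [X in _ <= X]eq_bigl => i do rewrite andbC.
rewrite -big_filter_cond (perm_big (seq.filter (mem s) t)) //.
apply: uniq_perm => // [|x]; first exact: filter_uniq.
by rewrite mem_filter /=; case: (boolP (x \in s)) => // /sub.
Qed.

Lemma total_size_sub (X Y : {fset object}) :
  {subset X <= Y} -> total_size X <= total_size Y.
Proof. by move=> sub; apply: leq_sum_sub; rewrite ?fset_uniq. Qed.

Lemma total_size_seq (X : {fset object}) (s : seq object) :
  uniq s -> X =i s -> total_size X = \sum_(x <- s) mu x.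
Proof. by move=> us e; apply: perm_big; apply: uniq_perm; rewrite ?fset_uniq. Qed.

Lemma update_sequence_deletes M s ds : update_sequence M s -> uniq ds ->
  {subset ds <= live s} -> update_sequence M (s ++ map Delete ds).
Proof.
elim/last_ind: ds => [|ds x IH] us; first by rewrite cats0.
rewrite rcons_uniq => /andP [xn ud] sub; rewrite map_rcons -rcons_cat.
apply: update_sequence_rcons; first by apply: IH => // y yd; apply: sub; rewrite mem_rcons inE yd orbT.
by rewrite /= mem_live_deletes xn sub // mem_rcons mem_head.
Qed.

Lemma update_sequence_inserts M s ls : update_sequence M s -> uniq ls ->
    {in ls, forall x, 0 < mu x /\ x \notin inserted s} ->
    total_size (live (s ++ map Insert ls)) <= M ->
  update_sequence M (s ++ map Insert ls).
Proof.
elim/last_ind: ls => [|ls x IH] us; first by rewrite cats0.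
rewrite rcons_uniq => /andP [xn ul] new tot.
have /new [mux xs] : x \in rcons ls x by rewrite mem_rcons mem_head.
rewrite map_rcons -rcons_cat in tot *; apply: update_sequence_rcons.
  apply: IH => // [y yl|]; first by apply: new; rewrite mem_rcons inE yl orbT.
  (* The live set only grows, so the bound on the last total covers the earlier ones. *)
  apply: leq_trans tot; apply: total_size_sub => y.
  by rewrite rcons_cat -map_rcons !mem_live_inserts mem_rcons inE => /orP [] ->; rewrite ?orbT.
by split => //; rewrite inserted_cat inserted_inserts mem_cat negb_or xs.
Qed.

Lemma update_sequence_prefix M s t : update_sequence M (s ++ t) -> update_sequence M s.
Proof.
elim/last_ind: t => [|t u IH]; first by rewrite cats0.
rewrite -rcons_cat => H; apply: IH; move: H; move Er : (rcons _ _) => r H.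
case: H Er => [/(congr1 size)|s' u' H _ /rcons_inj [-> _]] //.
by rewrite size_rcons.
Qed.

Lemma live_keep s t x : x \in live s ->
  all (fun u => if u is Delete y then y != x else true) t -> x \in live (s ++ t).
Proof.
rewrite live_cat; elim: t (live s) => [//|u t IH] X xX /= /andP [ux ut].
apply: IH => //; case: u ux => y /=; rewrite !inE ?xX ?orbT ?andbT //.
by rewrite eq_sym.
Qed.

(** * The update sequence *)

(* Round [j] replaces an [aobj] by a filler and flips the kind of one [bobj]:
   the live ones are [bobj K i] with [j <= i < j + K], so every [K] rounds all
   of them change from one kind to the other. *)
Definition unit_size (K : nat) : nat := 4 * cap K.
Definition zobj (K i : nat) : object := (i, unit_size K).
Definition aobj (K i : nat) : object := (i, unit_size K + 1).
Definition bobj (K i : nat) : object := (i, unit_size K + bdev K i).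
Definition fobj (K j : nat) : object := (j, unit_size K + fdev K j).
Definition dev (K : nat) (x : object) : nat := mu x - unit_size K.

Definition population (K n0 j : nat) : seq object :=
  map (zobj K) (iota 0 (n0 + j)) ++ map (aobj K) (iota j (nrounds K - j))
    ++ map (bobj K) (iota j K) ++ [:: fobj K j].

Definition kept (K n0 j : nat) : seq object :=
  map (zobj K) (iota 0 (n0 + j)) ++ map (aobj K) (iota j.+1 (nrounds K - j.+1))
    ++ map (bobj K) (iota j.+1 K.-1).

Definition removed (K j : nat) : seq object := [:: aobj K j; bobj K j; fobj K j].
Definition added (K n0 j : nat) : seq object :=
  [:: zobj K (n0 + j); bobj K (j + K); fobj K j.+1].

(** The deletions come first, so the total is back at the full memory only after the last
    insertion. *)
Definition round (K n0 j : nat) : seq update :=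
  map Delete (removed K j) ++ map Insert (added K n0 j).

Fixpoint history (K n0 j : nat) : seq update :=
  if j is j'.+1 then history K n0 j' ++ round K n0 j'
  else map Insert (population K n0 0).

(** The common total size of all the populations, so the memory is full before and after each
    round. *)
Definition memory (K n0 : nat) : nat :=
  (n0 + nrounds K + K + 1) * unit_size K + 3 * cap K.

Lemma map_const_iota (T : Type) (c : T) m n : map (fun=> c) (iota m n) = nseq n c.
Proof. by elim: n m => //= n IH m; rewrite IH. Qed.

Lemma map_dev_population K n0 j : map (dev K) (population K n0 j) = devs K n0 j.
Proof.
rewrite /population !map_cat -!map_comp /devs /=.
congr (_ ++ _ ++ _ ++ _).
- rewrite -(map_const_iota _ _ 0); apply: eq_map => i.
  by rewrite /dev /zobj /mu /= subnn.
- rewrite -(map_const_iota _ _ j); apply: eq_map => i.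
  by rewrite /dev /aobj /mu /= addKn.
- by apply: eq_map => i; rewrite /dev /bobj /mu /= addKn.
- by rewrite /dev /fobj /mu /= addKn.
Qed.

Lemma size_population K n0 j : j <= nrounds K ->
  size (population K n0 j) = n0 + nrounds K + K + 1.
Proof. by move=> jT; rewrite -(size_map (dev K)) map_dev_population size_devs. Qed.

Lemma perm_take_out (T : eqType) (a b f : T) (Z A B : seq T) :
  perm_eq (Z ++ (a :: A) ++ (b :: B) ++ [:: f]) ([:: a; b; f] ++ Z ++ A ++ B).
Proof. by apply/permP => P; do ?rewrite count_cat /=; lia. Qed.

Lemma perm_put_in (T : eqType) (z b f : T) (Z A B : seq T) :
  perm_eq ((Z ++ [:: z]) ++ A ++ (B ++ [:: b]) ++ [:: f]) ([:: z; b; f] ++ Z ++ A ++ B).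
Proof. by apply/permP => P; do ?rewrite count_cat /=; lia. Qed.

Lemma population_removed K n0 j : 0 < K -> j < nrounds K ->
  perm_eq (population K n0 j) (removed K j ++ kept K n0 j).
Proof.
case: K => [//|K] _ jT; rewrite /population /removed /kept subnS.
rewrite -[in X in perm_eq X _](prednK (_ : 0 < nrounds K.+1 - j)) ?subn_gt0 //.
exact: perm_take_out.
Qed.

Lemma population_added K n0 j : 0 < K -> j < nrounds K ->
  perm_eq (population K n0 j.+1) (added K n0 j ++ kept K n0 j).
Proof.
case: K => [//|K] _ jT; rewrite /population /added /kept.
have -> : iota 0 (n0 + j.+1) = iota 0 (n0 + j) ++ [:: n0 + j].
  by rewrite addnS -[(n0 + j).+1]addn1 iotaD.
have -> : iota j.+1 K.+1 = iota j.+1 K ++ [:: j + K.+1].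
  by rewrite -[K.+1]addn1 iotaD /= addn1 addSnnS.
rewrite !map_cat; exact: perm_put_in.
Qed.

Definition old (K n0 j : nat) (x : object) : bool :=
  let d := dev K x in
  if d == 0 then x.1 < n0 + j else
  if d == 1 then true else if d <= devB' K then x.1 < j + K else x.1 <= j.

Lemma old_zobj K n0 j i : old K n0 j (zobj K i) = (i < n0 + j).
Proof. by rewrite /old /dev /mu /= subnn. Qed.

Lemma old_aobj K n0 j i : old K n0 j (aobj K i).
Proof. by rewrite /old /dev /mu /= addKn. Qed.

Lemma bdev_bounds K i : 0 < K -> 1 < bdev K i <= devB' K.
Proof. by move=> /dev_order [h1 h2 _]; rewrite /bdev; case: odd; lia. Qed.

Lemma old_bobj K n0 j i : 0 < K -> old K n0 j (bobj K i) = (i < j + K).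
Proof.
move=> /(bdev_bounds _ i) /andP [b1 b2]; rewrite /old /dev /mu /= addKn.
by rewrite b2; case: eqP => [|_]; [lia | case: eqP => [|//]; lia].
Qed.

Lemma old_fobj K n0 j i : 0 < K -> old K n0 j (fobj K i) = (i <= j).
Proof.
move=> /dev_order [h1 h2 h3]; have := fdev_bounds K i.
rewrite /old /dev /mu /= addKn => fb.
case: eqP => [|_]; [lia | case: eqP => [|_]; first by lia].
by rewrite leqNgt (_ : devB' K < fdev K i) //; lia.
Qed.

Lemma uniq_population K n0 j : 0 < K -> uniq (population K n0 j).
Proof.
move=> K0; have [h1 h2 h3] := dev_order K K0; have := fdev_bounds K j => fb.
have bb i := bdev_bounds K i K0.
have inj1 (f : nat -> object) l : (forall i, (f i).1 = i) -> uniq l -> uniq (map f l).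
  by move=> f1; rewrite map_inj_uniq // => a b e; rewrite -(f1 a) -(f1 b) e.
have devz x l : x \in map (zobj K) l -> dev K x = 0.
  by case/mapP => i _ ->; rewrite /dev /mu /= subnn.
have deva x l : x \in map (aobj K) l -> dev K x = 1.
  by case/mapP => i _ ->; rewrite /dev /mu /= addKn.
have devb x l : x \in map (bobj K) l -> 1 < dev K x <= devB' K.
  by case/mapP => i _ ->; rewrite /dev /mu /= addKn.
have devf : dev K (fobj K j) = fdev K j by rewrite /dev /mu /= addKn.
rewrite /population !cat_uniq !inj1 ?iota_uniq //= !orbF !andbT !has_cat /= !orbF !negb_or.
repeat (apply/andP; split); try apply/hasPn => x.
- by move=> /deva e; apply/negP => /devz; lia.
- by move=> /devb e; apply/negP => /devz; lia.
- by apply/negP => /devz; lia.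
- by move=> /devb e; apply/negP => /deva; lia.
- by apply/negP => /deva; lia.
- by apply/negP => /devb; lia.
Qed.

Lemma sum_mu_dev K (l : seq object) : {in l, forall x, unit_size K <= mu x} ->
  \sum_(x <- l) mu x = size l * unit_size K + sumn (map (dev K) l).
Proof.
elim: l => [|x l IH] H; first by rewrite big_nil.
rewrite big_cons /= IH => [|y yl]; last by apply: H; rewrite inE yl orbT.
by have := H x (mem_head _ _); rewrite /dev; lia.
Qed.

Lemma mu_population K n0 j : {in population K n0 j, forall x, unit_size K <= mu x}.
Proof.
move=> x; rewrite !mem_cat inE => /or4P [/mapP [i _ ->]|/mapP [i _ ->]|/mapP [i _ ->]|/eqP ->];
  by rewrite /mu /= ?leq_addr.
Qed.

Lemma sum_mu_population K n0 j : 0 < K -> j <= nrounds K ->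
  \sum_(x <- population K n0 j) mu x = memory K n0.
Proof.
move=> K0 jT; rewrite (sum_mu_dev K); last exact: mu_population.
rewrite size_population // map_dev_population; congr (_ + _).
have [c1 cB cB' cf va] := count_devs K n0 j K0.
rewrite (sumn_content K (fdev K j)) ?c1 ?cB ?cB' ?cf //.
  by rewrite muln1 addnC fdev_content.
by have := fdev_bounds K j; lia.
Qed.

(** The third claim carries the induction: the objects added in round [j] are [old] for [j.+1] but
    not for [j], so they were never inserted before. *)
Lemma history_valid K n0 j : 0 < K -> j <= nrounds K ->
  [/\ update_sequence (memory K n0) (history K n0 j),
      live (history K n0 j) =i population K n0 j
    & {in inserted (history K n0 j), forall x, old K n0 j x}].
Proof.
move=> K0; elim: j => [|j IH] jT.
  have L0 : live (history K n0 0) =i population K n0 0.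
    by move=> x; rewrite -[history K n0 0]cat0s mem_live_inserts.
  split=> //.
  - rewrite -[history K n0 0]cat0s; apply: update_sequence_inserts.
    + exact: update_sequence_nil.
    + exact: uniq_population.
    + move=> x /mu_population; rewrite /unit_size => xs; split=> //.
      by have [h1 h2 h3] := dev_order K K0; lia.
    + rewrite cat0s (total_size_seq _ _ (uniq_population K n0 0 K0) L0).
      by rewrite sum_mu_population.
  - move=> x; rewrite /= inserted_inserts !mem_cat inE.
    move=> /or4P [/mapP [i + ->]|/mapP [i + ->]|/mapP [i + ->]|/eqP ->].
    + by rewrite mem_iota old_zobj; lia.
    + by move=> _; exact: old_aobj.
    + by rewrite mem_iota old_bobj //; lia.
    + by rewrite old_fobj.
have [us Lj oj] := IH (ltnW jT).
have pR := population_removed K n0 j K0 jT; have pA := population_added K n0 j K0 jT.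
have uR : uniq (removed K j ++ kept K n0 j) by rewrite -(perm_uniq pR) uniq_population.
have uA : uniq (added K n0 j ++ kept K n0 j) by rewrite -(perm_uniq pA) uniq_population.
have LD : live (history K n0 j ++ map Delete (removed K j)) =i kept K n0 j.
  move=> x; rewrite mem_live_deletes Lj (perm_mem pR) mem_cat.
  case: (boolP (x \in removed K j)) => [xr|_]; rewrite ?andbT //=.
  by move: uR; rewrite cat_uniq => /and3P [_ /hasPn H _]; apply/esym/negP => /H; rewrite xr.
have LJ : live (history K n0 j.+1) =i population K n0 j.+1.
  move=> x; rewrite /= catA mem_live_inserts LD (perm_mem pA) [RHS]mem_cat.
  exact: orbC.
have newA : {in added K n0 j, forall x, old K n0 j.+1 x && ~~ old K n0 j x}.
  move=> x; rewrite !inE => /or3P [] /eqP ->; rewrite ?old_zobj ?old_bobj ?old_fobj //; lia.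
split=> //.
- rewrite /= catA; apply: update_sequence_inserts.
  + apply: update_sequence_deletes => //.
      by move: uR; rewrite cat_uniq => /and3P [].
    by move=> x xr; rewrite Lj (perm_mem pR) mem_cat xr.
  + by move: uA; rewrite cat_uniq => /and3P [].
  + move=> x xA; split.
      have : x \in population K n0 j.+1 by rewrite (perm_mem pA) mem_cat xA.
      by move=> /mu_population; rewrite /unit_size; have [h1 h2 h3] := dev_order K K0; lia.
    rewrite inserted_cat inserted_deletes cats0; apply/negP => /oj.
    by have /andP [_ /negbTE ->] := newA x xA.
  + have := total_size_seq _ _ (uniq_population K n0 j.+1 K0) LJ.
    by rewrite sum_mu_population //= catA => ->.
- move=> x; rewrite /= !inserted_cat inserted_deletes inserted_inserts cat0s mem_cat.
  move=> /orP [/oj|/newA /andP [] //]; rewrite /old.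
  by case: (dev K x == 0); case: (dev K x == 1); case: (dev K x <= devB' K); lia.
Qed.

(** * Switching costs *)

Lemma inserted_size K n0 j : 0 < K -> {in inserted (history K n0 j),
  forall x, unit_size K <= mu x <= unit_size K + 3 * cap K}.
Proof.
move=> K0; have [h1 h2 h3] := dev_order K K0.
have fb i := fdev_bounds K i; have bb i := bdev_bounds K i K0.
elim: j => [|j IH] x /=.
  rewrite inserted_inserts !mem_cat inE.
  move=> /or4P [/mapP [i _ ->]|/mapP [i _ ->]|/mapP [i _ ->]|/eqP ->]; rewrite /mu /=.
  - by rewrite leqnn leq_addr.
  - by lia.
  - by have := bb i; lia.
  - by have := fb 0; lia.
rewrite !inserted_cat inserted_deletes inserted_inserts cat0s mem_cat.
move=> /orP [/IH //|]; rewrite !inE => /or3P [] /eqP ->; rewrite /mu /=.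
- by rewrite leqnn leq_addr.
- by have := bb (j + K); lia.
- by have := fb j.+1; lia.
Qed.

Lemma sumn_take i (s : seq nat) : sumn (take i s) <= sumn s.
Proof. by rewrite -{2}(cat_take_drop i s) sumn_cat leq_addr. Qed.

Lemma ncount_nth (T : Type) (x0 : T) (P : pred T) (w : seq T) :
  ncount (size w) (fun i => P (nth x0 w i)) = count P w.
Proof.
rewrite /ncount -sum1_count [RHS]big_mkcond (big_nth x0) big_mkord.
by apply: eq_bigr => i _; case: (P _).
Qed.

Lemma leq_ncount_pred N (P Q : pred nat) :
  (forall i, i < N -> P i -> Q i) -> ncount N P <= ncount N Q.
Proof. by move=> H; apply: leq_sum => i _; case: (boolP (P i)) => // /H ->. Qed.

Definition word (K n0 : nat) (B : seq update -> object -> nat) (j : nat) : seq nat :=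
  map (dev K) (tiling_order (B (history K n0 j)) (live (history K n0 j))).

Definition disturbed (K n0 : nat) (B : seq update -> object -> nat) (j : nat) : nat :=
  ncount (n0 + nrounds K + K + 1) (fun i =>
    sumn (take i (word K n0 B j)) != sumn (take i (word K n0 B j.+1))).

Lemma perm_live K n0 j : 0 < K -> j <= nrounds K ->
  perm_eq (live (history K n0 j)) (population K n0 j).
Proof.
move=> K0 /(history_valid K n0 j K0) [_ L _].
by apply: uniq_perm; rewrite ?fset_uniq ?uniq_population.
Qed.

Lemma perm_word K n0 B j : 0 < K -> j <= nrounds K ->
  perm_eq (word K n0 B j) (devs K n0 j).
Proof.
move=> K0 jT; rewrite -map_dev_population; apply: perm_map.
exact: perm_trans (perm_tiling_order _ _) (perm_live _ _ _ K0 jT).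
Qed.

Lemma sumn_word K n0 B j : 0 < K -> j <= nrounds K -> sumn (word K n0 B j) = 3 * cap K.
Proof.
move=> K0 jT; rewrite (perm_sumn (perm_word _ _ _ _ K0 jT)).
have := sum_mu_population K n0 j K0 jT.
rewrite (sum_mu_dev K); last exact: mu_population.
by rewrite size_population // map_dev_population => /addnI.
Qed.

Lemma tiling_position K n0 (B : seq update -> object -> nat) j x0 i
    (w := tiling_order (B (history K n0 j)) (live (history K n0 j))) :
    0 < K -> j <= nrounds K ->
    allocation (memory K n0) (live (history K n0 j)) (B (history K n0 j)) ->
    i < n0 + nrounds K + K + 1 ->
  B (history K n0 j) (nth x0 w i) = i * unit_size K + sumn (take i (word K n0 B j)).
Proof.
move=> K0 jT al iN; have pl := perm_live K n0 j K0 jT.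
have pw := perm_trans (perm_tiling_order (B (history K n0 j)) _) pl.
have sz : size w = n0 + nrounds K + K + 1 by rewrite (perm_size pw) size_population.
rewrite (full_tiling _ _ _ al).
- rewrite (sum_mu_dev K).
    by rewrite size_take sz iN /word -map_take.
  by move=> x /mem_take; rewrite (perm_mem pw) => /mu_population.
- move=> x; rewrite (perm_mem pl) => /mu_population; rewrite /unit_size.
  by have [h1 h2 h3] := dev_order K K0; lia.
- by rewrite /total_size (perm_big _ pl) sum_mu_population.
- by rewrite (perm_size pl) size_population.
Qed.

(** If the object at rank [i] of the new state is kept and has not moved, its address gives it the
    same rank and the same prefix sum in the old state. So a disturbed rank holds one of the 3 added
    objects or a moved one. *)
Lemma disturbed_leq K n0 (B : seq update -> object -> nat) j : 0 < K -> j < nrounds K ->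
    (forall s, update_sequence (memory K n0) s -> allocation (memory K n0) (live s) (B s)) ->
  disturbed K n0 B j <=
    3 + count (fun y => B (history K n0 j) y != B (history K n0 j.+1) y) (kept K n0 j).
Proof.
move=> K0 jT al.
have [us1 L1 _] := history_valid K n0 j K0 (ltnW jT).
have [us2 L2 _] := history_valid K n0 j.+1 K0 jT.
have pR := population_removed K n0 j K0 jT; have pA := population_added K n0 j K0 jT.
pose phi := B (history K n0 j); pose phi' := B (history K n0 j.+1).
pose w := tiling_order phi (live (history K n0 j)).
pose w' := tiling_order phi' (live (history K n0 j.+1)).
have pw : perm_eq w (population K n0 j).
  exact: perm_trans (perm_tiling_order _ _) (perm_live _ _ _ K0 (ltnW jT)).
have pw' : perm_eq w' (population K n0 j.+1).
  exact: perm_trans (perm_tiling_order _ _) (perm_live _ _ _ K0 jT).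
have sz : size w = n0 + nrounds K + K + 1 by rewrite (perm_size pw) size_population // ltnW.
have sz' : size w' = n0 + nrounds K + K + 1 by rewrite (perm_size pw') size_population.
pose Q x := (x \in added K n0 j) || (phi x != phi' x).
have : count Q w' <= 3 + count (fun y => phi y != phi' y) (kept K n0 j).
  rewrite (permP pw') (permP pA) count_cat; apply: leq_add; first exact: count_size.
  rewrite (@eq_in_count _ _ (fun y => phi y != phi' y)) // => y yk; rewrite /Q.
  have : uniq (added K n0 j ++ kept K n0 j) by rewrite -(perm_uniq pA) uniq_population.
  by rewrite cat_uniq => /and3P [_ /hasPn /(_ y yk) /negbTE ->].
apply: leq_trans; rewrite -(ncount_nth _ (0, 0)) sz' /disturbed.
apply: leq_ncount_pred => i iN; apply: contraNT; rewrite negb_or negbK => /andP [na /eqP ephi].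
set x := nth _ w' i in na ephi *.
have xw' : x \in w' by rewrite mem_nth // sz'.
have xw : x \in w.
  by move: xw'; rewrite (perm_mem pw') (perm_mem pA) (perm_mem pw) (perm_mem pR) !mem_cat (negbTE na) /= => ->; rewrite orbT.
have iN' : index x w < n0 + nrounds K + K + 1 by rewrite -sz index_mem.
have e1 := tiling_position K n0 B j (0, 0) _ K0 (ltnW jT) (al _ us1) iN'.
have e2 := tiling_position K n0 B j.+1 (0, 0) i K0 jT (al _ us2) iN.
rewrite -/phi -/w nth_index // in e1; rewrite -/phi' -/w' -/x -ephi e1 in e2.
have b1 := sumn_take (index x w) (word K n0 B j); have b2 := sumn_take i (word K n0 B j.+1).
rewrite sumn_word ?(ltnW jT) // in b1; rewrite sumn_word // in b2.
(* All deviations together are below one unit, so an address has the rank as quotient and the prefix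
   sum as remainder. *)
have su : 3 * cap K < unit_size K by rewrite /unit_size; have [h1 h2 h3] := dev_order K K0; lia.
have ii : index x w = i.
  by move: e2; rewrite ![_ * unit_size K]mulnC; nia.
by move: e2; rewrite ii => /addnI ->.
Qed.

Definition moment (K n0 j l : nat) : seq update := history K n0 j ++ take l (round K n0 j).
Definition request (K n0 j l : nat) : update := nth (Delete (0, 0)) (round K n0 j) l.

Definition step_cost (B : seq update -> object -> nat) (h : seq update) (u : update) : nat :=
  switching_cost (live h) u (B h) (B (rcons h u)).

Lemma rcons_moment K n0 j l : l < 6 ->
  rcons (moment K n0 j l) (request K n0 j l) = moment K n0 j l.+1.
Proof. by move=> l6; rewrite /moment rcons_cat (take_nth (Delete (0, 0))). Qed.

Lemma kept_moment K n0 j l : 0 < K -> j < nrounds K ->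
  {subset kept K n0 j <= live (moment K n0 j l)}.
Proof.
move=> K0 jT x xk; have pR := population_removed K n0 j K0 jT.
have [_ L _] := history_valid K n0 j K0 (ltnW jT).
apply: live_keep; first by rewrite L (perm_mem pR) mem_cat xk orbT.
have : uniq (removed K j ++ kept K n0 j) by rewrite -(perm_uniq pR) uniq_population.
rewrite cat_uniq => /and3P [_ /hasPn /(_ x xk) xr _].
suff : all (fun u => if u is Delete y then y != x else true) (round K n0 j).
  by rewrite -{1}(cat_take_drop l (round K n0 j)) all_cat => /andP [].
rewrite all_cat; apply/andP; split; last by elim: (added K n0 j).
by elim: (removed K j) xr => //= y s IH; rewrite inE negb_or eq_sym => /andP [-> /IH].
Qed.

Lemma change_somewhere (f : nat -> nat) n :
  f 0 != f n -> 0 < \sum_(l < n) (f l != f l.+1).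
Proof.
elim: n => [|n IH]; first by rewrite eqxx.
rewrite big_ord_recr /=; case: (eqVneq (f n) (f n.+1)) => [<- /IH|_ _]; rewrite ?addn0 ?addn1 //.
Qed.

(** Each of the six updates costs at least one unit for its own object and one for every kept object
    it moves, and a kept object whose address differs after the round has moved in some update. The
    six own units cover the 3 of [disturbed_leq]. *)
Lemma round_cost K n0 (B : seq update -> object -> nat) j : 0 < K -> j < nrounds K ->
    (forall s, update_sequence (memory K n0) s -> allocation (memory K n0) (live s) (B s)) ->
  unit_size K * disturbed K n0 B j <=
    \sum_(l < 6) step_cost B (moment K n0 j l) (request K n0 j l).
Proof.
move=> K0 jT al; pose phi l := B (moment K n0 j l).
have pR := population_removed K n0 j K0 jT; have pA := population_added K n0 j K0 jT.
have uk : uniq (kept K n0 j).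
  have : uniq (removed K j ++ kept K n0 j) by rewrite -(perm_uniq pR) uniq_population.
  by rewrite cat_uniq => /and3P [].
have mk : {in kept K n0 j, forall x, unit_size K <= mu x}.
  by move=> x xk; apply: (mu_population _ n0 j); rewrite (perm_mem pR) mem_cat xk orbT.
have cost_l l : l < 6 -> unit_size K * (1 + \sum_(y <- kept K n0 j) (phi l y != phi l.+1 y))
    <= step_cost B (moment K n0 j l) (request K n0 j l).
  move=> l6; rewrite mulnDr muln1 /step_cost /switching_cost rcons_moment //.
  apply: leq_add.
    have : updated_object (request K n0 j l) \in removed K j ++ added K n0 j.
      by case: l l6 => [|[|[|[|[|[|[]]]]]]] //= _; rewrite !inE eqxx ?orbT.
    rewrite mem_cat => /orP [x|x].
      by apply: (mu_population _ n0 j); rewrite (perm_mem pR) mem_cat x.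
    by apply: (mu_population _ n0 j.+1); rewrite (perm_mem pA) mem_cat x.
  apply: (@leq_trans (\sum_(y <- kept K n0 j | phi l y != phi l.+1 y) mu y)).
    rewrite [X in _ <= X]big_mkcond big_distrr /= big_seq [X in _ <= X]big_seq.
    by apply: leq_sum => y /mk ys; case: ifP => _; rewrite ?muln1 ?muln0.
  apply: leq_sum_sub => //; first exact: fset_uniq.
  move=> y yk; rewrite in_fsetI kept_moment //=.
  have := kept_moment K n0 j l.+1 K0 jT y yk.
  by rewrite -rcons_moment // -cats1 live_cat.
apply: (@leq_trans (\sum_(l < 6) unit_size K *
    (1 + \sum_(y <- kept K n0 j) (phi l y != phi l.+1 y)))); last first.
  by apply: leq_sum => l _; apply: cost_l.
rewrite -big_distrr leq_mul2l; apply/orP; right.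
rewrite big_split sum_nat_const card_ord /= exchange_big /=.
apply: leq_trans (disturbed_leq _ _ _ _ K0 jT al) _; apply: leq_add => //.
rewrite -sum1_count big_mkcond; apply: leq_sum => y _; case: ifP => // ne.
apply: (change_somewhere (fun l => phi l y) 6); move: ne.
by rewrite /phi /moment take0 cats0.
Qed.

(** Cauchy-Schwarz, by [2 * x * y <= x ^ 2 + y ^ 2] for all pairs. *)
Lemma sqr_sum_leq n (c : nat -> nat) : (\sum_(l < n) c l) ^ 2 <= n * \sum_(l < n) c l ^ 2.
Proof.
rewrite -(leq_pmul2l (ltn0Sn 1)) -mulnn big_distrlr /=.
apply: (@leq_trans (\sum_(l < n) \sum_(l' < n) (c l ^ 2 + c l' ^ 2))).
  rewrite big_distrr; apply: leq_sum => l _; rewrite big_distrr; apply: leq_sum => l' _.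
  exact: (nat_Cauchy _ _).1.
have inner l : \sum_(l' < n) (c l ^ 2 + c l' ^ 2) = n * c l ^ 2 + \sum_(l' < n) c l' ^ 2.
  by rewrite big_split /= sum_nat_const card_ord.
rewrite (eq_bigr _ (fun (l : 'I_n) _ => inner l)) big_split /= sum_nat_const card_ord -big_distrr /=.
by rewrite mul2n addnn.
Qed.

(** A bound for each single outcome of the random choices: 2000 comes from [words_bound], 6 from
    Cauchy-Schwarz over the updates of a round. *)
Lemma path_cost K n0 (B : seq update -> object -> nat) : 0 < K ->
    (forall s, update_sequence (memory K n0) s -> allocation (memory K n0) (live s) (B s)) ->
  unit_size K ^ 2 * (K * nrounds K) <= 6 * 2000 * \sum_(j < nrounds K) \sum_(l < 6)
    step_cost B (moment K n0 j l) (request K n0 j l) ^ 2.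
Proof.
move=> K0 al.
have := words_bound K n0 (word K n0 B) K0 (fun j jT => perm_word K n0 B j K0 jT).
move=> /(leq_mul (leqnn (unit_size K ^ 2))) H; apply: leq_trans H _.
rewrite mulnCA [6 * 2000]mulnC -mulnA leq_mul2l /=.
rewrite !big_distrr /=; apply: leq_sum => j _.
have := round_cost K n0 B j K0 (ltn_ord j) al; rewrite -leq_sqr expnMn => H.
exact: leq_trans H (sqr_sum_leq 6 (fun l => step_cost B (moment K n0 j l) (request K n0 j l))).
Qed.

(** * Orders of magnitude of the parameters *)

Lemma cap_bounds K : 0 < K -> 10 * K ^ 4 <= cap K <= 44 * K ^ 4.
Proof.
move=> K0; have -> : K ^ 4 = K * K * (K * K) by rewrite !expnS expn0; lia.
have -> : cap K = (10 * (K * K) + 1) * (K.+1 * K.+1).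
  by rewrite /cap /devB' /devB /nrounds; lia.
apply/andP; split.
  apply: (@leq_trans (10 * (K * K) * (K * K))); first by lia.
  by apply: leq_mul; [lia | apply: leq_mul].
apply: (@leq_trans (11 * (K * K) * (4 * (K * K)))); last by lia.
by apply: leq_mul; nia.
Qed.

(** Makes the number of objects exactly [20 * K ^ 3]; for positive [K] the subtraction is not
    truncated. *)
Definition fillers (K : nat) : nat := 20 * K ^ 3 - (nrounds K + K + 1).

Lemma memory_bounds K : 0 < K -> 800 * K ^ 7 <= memory K (fillers K) <= 3652 * K ^ 7.
Proof.
move=> K0; have := cap_bounds K K0.
(* There are [20 * K ^ 3] units of [4 * cap K], plus [3 * cap K]; then [800 = 80 * 10] and
   [3652 = 83 * 44]. *)
have -> : memory K (fillers K) = (80 * K ^ 3 + 3) * cap K.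
  have : nrounds K + K + 1 <= 20 * K ^ 3.
    by rewrite /nrounds !expnS expn0 muln1; nia.
  rewrite /memory /unit_size /fillers.
  by move: (K ^ 3) (nrounds K) (cap K) => x t c tx; rewrite (_ : _ + t + K + 1 = 20 * x); lia.
have -> : K ^ 7 = K ^ 3 * K ^ 4 by rewrite -expnD.
have : 0 < K ^ 3 by rewrite expn_gt0 K0.
move: (K ^ 3) (K ^ 4) (cap K) => x y c x0 /andP [lo hi]; apply/andP; split.
  by apply: (@leq_trans (80 * x * (10 * y))); [lia | apply: leq_mul => //; lia].
by apply: (@leq_trans (83 * x * (44 * y))); [apply: leq_mul => //; lia | lia].
Qed.

(** The largest [K] with [K ^ 7 <= M0] works, since [K.+1 <= 2 * K] and [128 = 2 ^ 7]. *)
Lemma seventh_root M0 : 0 < M0 -> exists2 K, 0 < K & K ^ 7 <= M0 <= 128 * K ^ 7.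
Proof.
move=> M00; suff [K K0 /andP [lo hi]] : exists2 K, 0 < K & K ^ 7 <= M0 < K.+1 ^ 7.
  exists K => //; rewrite lo; apply: leq_trans (ltnW hi) _.
  by rewrite (_ : 128 = 2 ^ 7) // -expnMn leq_exp2r //; lia.
elim: M0 M00 => // -[|M0] IH _; first by exists 1.
have [//|K K0 /andP [lo hi]] := IH.
have [le|lt] := leqP (K.+1 ^ 7) M0.+2; last by exists K => //; rewrite lt (leq_trans lo).
exists K.+1 => //; rewrite le /=.
by apply: leq_ltn_trans (_ : K.+1 ^ 7 < _); rewrite ?ltn_exp2r.
Qed.

Lemma path_cost_pow K (B : seq update -> object -> nat) : 0 < K ->
    (forall s, update_sequence (memory K (fillers K)) s ->
       allocation (memory K (fillers K)) (live s) (B s)) ->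
  K ^ 9 * nrounds K <= 8 * \sum_(j < nrounds K) \sum_(l < 6)
    step_cost B (moment K (fillers K) j l) (request K (fillers K) j l) ^ 2.
Proof.
move=> K0 /(path_cost K (fillers K) B K0); set S := (X in _ -> _ <= 8 * X) => H.
have /andP [lo _] := cap_bounds K K0.
(* [unit_size K] is at least [40 * K ^ 4]; the factor 8 then suffices, as [12000 <= 8 * 1600]. *)
have sz : 1600 * (K ^ 8) <= unit_size K ^ 2.
  rewrite (_ : 1600 * K ^ 8 = (40 * K ^ 4) ^ 2) ?leq_sqr ?/unit_size; first by lia.
  by rewrite expnMn -expnM.
have : 1600 * (K ^ 9 * nrounds K) <= 6 * 2000 * S.
  apply: leq_trans H; rewrite expnS [K * _]mulnC -mulnA mulnA.
  by rewrite leq_mul2r sz orbT.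
by move: S {H} (K ^ 9 * nrounds K) => S X; lia.
Qed.

(** * Expected costs and averaging over the requests *)

Import Order.TTheory GRing.Theory Num.Theory.
Local Open Scope ring_scope.
Lemma measurable_sq_cost (R : realType) (M : nat) (d : measure_display)
    (Omega : measurableType d) (A : Omega -> seq update -> object -> nat) h u :
    randomized_allocator M A -> update_sequence M (rcons h u) ->
  measurable_fun [set: Omega]
    (fun w => ((step_cost (A w) h u ^ 2)%N%:R : R)).
Proof.
move=> HA us; have us0 : update_sequence M h.
  by move: us; rewrite -cats1; exact: update_sequence_prefix.
have [_ mh] := HA _ us0; have [_ mu'] := HA _ us.
pose Y := (live h `&` step (live h) u)%fset.
(* The test [y \in Y] makes the summand measurable for every [y]: off [Y] it is the constant 0. *)
have -> : (fun w => ((step_cost (A w) h u ^ 2)%N%:R : R)) =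
    (fun w => ((mu (updated_object u))%:R + \sum_(y <- Y)
      (if (y \in Y) && (A w h y != A w (rcons h u) y) then (mu y)%:R else 0)) ^+ 2).
  apply/funext => w; rewrite natrX /step_cost /switching_cost natrD natr_sum; congr (_ ^+ 2).
  congr (_ + _); rewrite big_mkcond big_seq [RHS]big_seq /=.
  by apply: eq_bigr => y yY; rewrite yY.
apply: measurable_funX; apply: measurable_funD; first exact: measurable_cst.
apply: measurable_sum => y; case: (boolP (y \in Y)) => [yY|_]; last exact: measurable_cst.
have [yh yu] : y \in live h /\ y \in live (rcons h u).
  by move: yY; rewrite in_fsetI -cats1 live_cat => /andP [].
apply: measurable_fun_ifT; try exact: measurable_cst.
apply: measurable_neg; apply: measurable_fun_eqn; [exact: mh | exact: mu'].
Qed.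

Lemma exists_ge_average (R : realType) (I : finType) (e : I -> \bar R) (v : R) :
    (0 < #|I|)%N -> (forall i, (0 <= e i)%E) ->
    ((v * #|I|%:R)%:E <= \sum_i e i)%E ->
  exists i, (v%:E <= e i)%E.
Proof.
move=> I0 e0 le; apply: contrapT => /forallNP no.
have lt i : (e i < v%:E)%E by rewrite ltNge; apply/negP.
have fin i : e i \is a fin_num.
  by rewrite ge0_fin_numE // (lt_trans (lt i)) // ltry.
move: le; rewrite leNgt => /negP; apply.
rewrite (eq_bigr (fun i => (fine (e i))%:E)) => [|i _]; last by rewrite fineK.
rewrite sumEFin lte_fin -sum1_card natr_sum mulr_sumr.
have /card_gt0P [i0 _] := I0.
apply: ltr_sum => [|i _]; last by rewrite mulr1 -lte_fin fineK.
by apply/hasP; exists i0; rewrite ?mem_index_enum.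
Qed.

(** The factor between [K ^ 7] and [M] enters with the exponent [e / 7], which is at most 2. *)
Lemma powR_seventh_bounds (R : realType) (b K M e : nat) :
    (0 < b)%N -> (e <= 14)%N -> (K ^ 7 <= M <= b * K ^ 7)%N ->
  K%:R ^+ e <= (M%:R : R) `^ (e%:R / 7%:R) <= b%:R ^+ 2 * K%:R ^+ e.
Proof.
move=> b0 e14 /andP [lo hi].
have root : (K%:R ^+ 7 : R) `^ (e%:R / 7%:R) = K%:R ^+ e.
  by rewrite -powR_mulrn // -powRrM mulrCA divff ?mulr1 ?powR_mulrn // pnatr_eq0.
have e7 : 0 <= (e%:R / 7%:R : R) by rewrite divr_ge0.
apply/andP; split.
  rewrite -root; apply: ge0_ler_powR; rewrite ?nnegrE ?exprn_ge0 //.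
  by rewrite -natrX ler_nat.
apply: (@le_trans _ _ ((b%:R * K%:R ^+ 7 : R) `^ (e%:R / 7%:R))).
  apply: ge0_ler_powR; rewrite ?nnegrE ?mulr_ge0 ?exprn_ge0 //.
  by rewrite -natrX -natrM ler_nat.
rewrite powRM ?exprn_ge0 // root ler_wpM2r ?exprn_ge0 //.
rewrite -powR_mulrn //; apply: ler_powR; first by rewrite ler1n.
by rewrite ler_pdivrMr // -natrM ler_nat.
Qed.

(** The requests do not depend on the outcome, so the bound of [path_cost_pow] can be integrated;
    averaging over [6 * nrounds K] requests gives [48 = 8 * 6]. *)
Lemma exists_costly_request (R : realType) (K : nat) (d : measure_display)
    (Omega : measurableType d) (P : probability Omega R)
    (A : Omega -> seq update -> object -> nat) (n0 := fillers K) :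
    (0 < K)%N -> randomized_allocator (memory K n0) A ->
  exists j l, [/\ (j < nrounds K)%N, (l < 6)%N &
    ((K%:R ^+ 9 / 48%:R)%:E
       <= expected_sq_cost P A (moment K n0 j l) (request K n0 j l))%E].
Proof.
move=> K0 HA; pose I : finType := ('I_(nrounds K) * 'I_6)%type.
pose X (i : I) (w : Omega) : R :=
  (step_cost (A w) (moment K n0 i.1 i.2) (request K n0 i.1 i.2) ^ 2)%N%:R.
have T0 : (0 < nrounds K)%N by rewrite /nrounds; nia.
have cardI : #|I| = (nrounds K * 6)%N by rewrite card_prod !card_ord.
have valid j l : (j < nrounds K)%N -> update_sequence (memory K n0) (moment K n0 j l).
  move=> jT; have [us _ _] := history_valid K n0 j.+1 K0 jT.
  apply: (@update_sequence_prefix _ _ (drop l (round K n0 j))).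
  by rewrite /moment -catA cat_take_drop.
have mX i : measurable_fun [set: Omega] (X i).
  apply: (measurable_sq_cost R (memory K n0)) => //.
  by rewrite rcons_moment //; apply: valid.
have X0 i w : 0 <= X i w by rewrite ler0n.
have [||| i ge] := exists_ge_average R I
    (fun i => (\int[P]_w (X i w)%:E)%E) (K%:R ^+ 9 / 48%:R).
- by rewrite cardI; lia.
- by move=> i; apply: integral_ge0 => w _; rewrite lee_fin.
- rewrite -ge0_integral_sum //; last 2 first.
  + by move=> i; apply/measurable_EFinP.
  + by move=> i w _; rewrite lee_fin.
  rewrite -[leLHS]mule1 -(probability_setT P) -integral_cst //.
  apply: ge0_le_integral => //.
  + by move=> w _; rewrite lee_fin mulr_ge0 // divr_ge0 // exprn_ge0.
  + apply: emeasurable_sum => i; exact/measurable_EFinP.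
  move=> w _; rewrite sumEFin lee_fin cardI.
  have := path_cost_pow K (A w) K0 (fun s us => (HA s us).1 w).
  rewrite pair_big /= -(ler_nat R) [(K ^ 9 * _)%:R]natrM natrX [(8 * _)%:R]natrM natr_sum => H.
  set S := \sum_(i <- _) _.
  have {}H : K%:R ^+ 9 * (nrounds K)%:R <= 8%:R * S :> R by exact: H.
  lra.
exists i.1, i.2; split => //.
by move: ge; rewrite /expected_sq_cost unlock.
Qed.

Theorem theorem5p2 (R : realType) :
  exists c c1 c2 c3 c4 : R,
    [/\ 0 < c, 0 < c1, 0 < c2, 0 < c3 & 0 < c4] /\
    forall M0 : nat, (0 < M0)%N ->
    exists M : nat,
      c1 * M0%:R <= M%:R <= c2 * M0%:R /\
      forall (d : measure_display) (Omega : measurableType d)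
             (P : probability Omega R)
             (A : Omega -> seq update -> object -> nat),
        randomized_allocator M A ->
        exists s : seq update,
          [/\ update_sequence M s,
              forall x, x \in inserted s ->
                c3 * M%:R `^ (4%:R / 7%:R) <= (mu x)%:R
                  <= c4 * M%:R `^ (4%:R / 7%:R)
            & exists (h : seq update) (u : update) (t : seq update),
                s = h ++ u :: t /\
                ((c * M%:R `^ (9%:R / 7%:R))%:E
                  <= expected_sq_cost P A h u)%E].
Proof.
(* [b] keeps 3652 abstract; 308 is [7 * 44], as sizes are at most [7 * cap K]. *)
have [b b308 memory_b] : exists2 b, (308 <= b)%N & forall K, (0 < K)%N ->
    (800 * K ^ 7 <= memory K (fillers K) <= b * K ^ 7)%N.
  by exists 3652; [|exact: memory_bounds].
have b0 : (0 < b)%N by lia.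
pose q : R := b%:R ^+ 2; have q0 : 0 < q by rewrite exprn_gt0 ?ltr0n.
(* [M] lies between [128 * K ^ 7] and [b * K ^ 7], and sizes between [K ^ 4] and [b * K ^ 4]; [q]
   bounds the loss in replacing [M] to the power 4/7 or 9/7 by [K ^ 4] or [K ^ 9]. *)
exists ((48%:R * q)^-1), 1, b%:R, q^-1, b%:R.
split; first by split; rewrite ?invr_gt0 ?mulr_gt0 ?ltr0n.
move=> M0 /seventh_root [K K0 /andP [lo hi]].
exists (memory K (fillers K)).
have Mb := memory_b K K0; set M := memory _ _ in Mb *.
have K7 : (K ^ 7 <= M <= b * K ^ 7)%N by move: Mb; move: (K ^ 7)%N => k; lia.
split.
  rewrite mul1r -natrM !ler_nat; have /andP [Mlo Mhi] := Mb.
  apply/andP; split; first by move: Mlo hi; move: (K ^ 7)%N => k; lia.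
  by apply: leq_trans Mhi _; rewrite leq_mul2l lo orbT.
move=> d Omega P A HA; exists (history K (fillers K) (nrounds K)).
have [us _ _] := history_valid K (fillers K) _ K0 (leqnn (nrounds K)).
split=> //.
  move=> x /(inserted_size _ _ _ K0) /andP [xlo xhi].
  have /andP [clo chi] := cap_bounds K K0.
  have /andP [plo phi] := powR_seventh_bounds R b K M 4 b0 isT K7.
  have k4 : (K%:R ^+ 4 : R) = (K ^ 4)%N%:R by rewrite natrX.
  rewrite k4 in plo phi; apply/andP; split.
    rewrite mulrC ler_pdivrMr //; apply: le_trans phi _.
    rewrite -/q mulrC ler_pM2r // ler_nat.
    by move: xlo clo; rewrite /unit_size; lia.
  apply: (@le_trans _ _ (b%:R * (K ^ 4)%N%:R)); last by rewrite ler_wpM2l.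
  by rewrite -natrM ler_nat; move: xhi chi; rewrite /unit_size; nia.
have [j [l [jT l6 ge]]] := exists_costly_request R K d Omega P A K0 HA.
exists (moment K (fillers K) j l), (request K (fillers K) j l).
(* The sequence is the whole history for every allocator; only the place where it is split depends
   on the allocator. *)
have [t Et] : exists t, history K (fillers K) (nrounds K) = moment K (fillers K) j l.+1 ++ t.
  have [t ->] : exists t, history K (fillers K) (nrounds K) = history K (fillers K) j.+1 ++ t.
    elim: (nrounds K) jT => // n IH; rewrite ltnS leq_eqVlt => /predU1P [->|/IH [t E]].
      by exists [::]; rewrite cats0.
    by exists (t ++ round K (fillers K) n); rewrite /= E catA.
  exists (drop l.+1 (round K (fillers K) j) ++ t).
  by rewrite catA /moment -[(_ ++ take _ _) ++ _]catA cat_take_drop.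
exists t; split; first by rewrite Et -rcons_moment // cat_rcons.
apply: le_trans ge; rewrite lee_fin.
have /andP [_ phi] := powR_seventh_bounds R b K M 9 b0 isT K7.
apply: (@le_trans _ _ ((48%:R * q)^-1 * (q * K%:R ^+ 9))).
  by rewrite ler_pM2l ?phi // invr_gt0 mulr_gt0 // ltr0n.
by rewrite invfM mulrA mulfVK ?gt_eqF // mulrC.
Qed.
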